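(* Let $(X,\mathcal{A},g,\mu)$ be a dynamical system, where $X$ is a compact metric space, $\mathcal{A}$ is a $\sigma$-algebra on $X$ containing the Borel sets, $g:X\to X$ is measurable and $\mu$ is a $g$-invariant probability measure on $(X,\mathcal{A})$. Suppose that $\mu$ is exact dimensional, with dimension $d_\mu$. Then for every $\epsilon>0$, $$\liminf_{r\to 0}\frac{1}{\log r}\log\mu\left(\tau_r\ge r^{-d_\mu-\epsilon}\right)\ \ge\ \sup_{\gamma\in(0,1)}\min\left\{(1-\gamma)\epsilon,\ \underline{\psi}(\gamma\epsilon)\right\}$$ and $$\liminf_{r\to 0}\frac{1}{\log r}\log\mu\left(\tau_r\le r^{-d_\mu+\epsilon}\right)\ \ge\ \sup_{\gamma\in(0,1),\ a>0,\ \epsilon''>0}\min\left\{-\gamma\epsilon-\epsilon''+a,\ \underline{\psi}(\gamma\epsilon),\ \underline{\varphi}(a,\epsilon),\ \underline{\psi}(-\epsilon'')\right\},$$ whatever the choice of the constants $C=C(a,\epsilon)>0$ in the definition of $\underline{\varphi}(a,\epsilon)$.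
   Context: For a measurable set $A\subset X$ and $x\in X$, $\tau_A(x)=\min\{n\ge 1: g^n x\in A\}$ (with $\min\emptyset=+\infty$). For $r>0$, $B(x,r)$ is the ball of center $x$ and radius $r$, and $\tau_r(x)=\tau_{B(x,r)}(x)=\min\{n\ge1: d(g^nx,x)<r\}$. For a measurable set $B$ with $\mu(B)>0$, $\mu_B(\cdot)=\mu(\cdot\cap B)/\mu(B)$. The measure $\mu$ is exact dimensional if there is a constant $d_\mu$ such that $\lim_{r\to0}\frac{\log\mu(B(x,r))}{\log r}=d_\mu$ for $\mu$-almost every $x\in X$. Exponential rate for dimension: for $\epsilon>0$, $$\underline{\psi}(\pm\epsilon)=\liminf_{r\to0}\frac{1}{\log r}\log\mu\left(\left\{x:\frac{\log\mu(B(x,r))}{-\log r}\in I_{\pm\epsilon}\right\}\right),$$ where $I_{\epsilon}=(-\infty,-d_\mu-\epsilon)$ and $I_{-\epsilon}=(-d_\mu+\epsilon,+\infty)$. Exponential rate for fast return times: for $\epsilon,a>0$, $$\underline{\varphi}(a,\epsilon)=\liminf_{r\to0}\frac{1}{\log r}\log\mu\left(\left\{x_0:\mu_{B(x_0,2r)}\left(\tau_{B(x_0,2r)}\le r^{-d_\mu+\epsilon}\right)\ge Cr^a\right\}\right),$$ for some constant $C>0$ (independent of $r$ and $x_0$). Convention: for $0<r<1$, $\frac{1}{\log r}\log 0=+\infty$; rates take values in $[0,+\infty]$. *)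

(* Defs.v *)
From HB Require Import structures.
From mathcomp Require Import all_boot all_order all_algebra.
From mathcomp Require Import all_classical all_reals all_analysis.

Set Implicit Arguments.
Unset Strict Implicit.
Unset Printing Implicit Defensive.

Import Order.TTheory GRing.Theory Num.Theory.
Import numFieldNormedType.Exports.

Local Open Scope classical_set_scope.
Local Open Scope ring_scope.

(* A metric space with a sigma-algebra on it. The structure does not relate the
   two; that every Borel set is measurable is a separate hypothesis. *)
#[short(type="measurableMetricType")]
HB.structure Definition MeasurableMetric (disp : measure_display)
    (R : numDomainType) :=
  { X of Measurable disp X & Metric R X }.

Definition measure_invariant (disp : measure_display) (R : realType)
    (X : measurableMetricType disp R) (mu : probability X R) (g : X -> X) :=
  forall A : set X, measurable A -> mu (g @^-1` A) = mu A.

(* The infimum of a nonempty set of integers is its minimum; the infimum of the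
   empty set is +oo. *)
Definition hitting_time (R : realType) (X : Type) (g : X -> X)
    (A : set X) (x : X) : \bar R :=
  ereal_inf [set n%:R%:E | n in [set n : nat | (1 <= n)%N /\ A (iter n g x)]].

Definition return_time (disp : measure_display) (R : realType)
    (X : measurableMetricType disp R) (g : X -> X) (r : R) (x : X) : \bar R :=
  hitting_time R g (ball x r) x.

(* Meaningful only when 0 < mu B. *)
Definition conditional (disp : measure_display) (R : realType)
    (X : measurableMetricType disp R) (mu : probability X R)
    (B A : set X) : \bar R :=
  (mu (A `&` B) / mu B)%E.

(* Here lne 0 = -oo, so for 0 < r < 1 the quotient is +oo when mu (S r) = 0. *)
Definition lower_rate (disp : measure_display) (R : realType)
    (X : measurableMetricType disp R) (mu : probability X R)
    (S : R -> set X) : \bar R :=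
  limf_einf (fun r : R => ((ln r)^-1%:E * lne (mu (S r)))%E) (0 : R)^'+.

Definition exact_dimensional (disp : measure_display) (R : realType)
    (X : measurableMetricType disp R) (mu : probability X R) (dmu : R) :=
  {ae mu, forall x : X,
    (lne (mu (ball x r)) / (ln r)%:E)%E @[r --> (0 : R)^'+] --> dmu%:E}.

Definition psi_on (disp : measure_display) (R : realType)
    (X : measurableMetricType disp R) (mu : probability X R)
    (I : set (\bar R)) : \bar R :=
  lower_rate mu (fun r => [set x | I (lne (mu (ball x r)) / (- ln r)%:E)%E]).

(* psi_pos dmu e and psi_neg dmu e are the rates psi(+e) and psi(-e). The
   intervals are taken in \bar R: the first one contains -oo, the value of the
   quotient where mu (ball x r) = 0, which only happens outside the support. *)
Definition psi_pos (disp : measure_display) (R : realType)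
    (X : measurableMetricType disp R) (mu : probability X R)
    (dmu e : R) : \bar R :=
  psi_on mu `]-oo, ((- dmu - e)%:E : \bar R)[.

Definition psi_neg (disp : measure_display) (R : realType)
    (X : measurableMetricType disp R) (mu : probability X R)
    (dmu e : R) : \bar R :=
  psi_on mu `]((- dmu + e)%:E : \bar R), +oo[.

Definition varphi (disp : measure_display) (R : realType)
    (X : measurableMetricType disp R) (mu : probability X R) (g : X -> X)
    (dmu C a e : R) : \bar R :=
  lower_rate mu (fun r => [set x0 : X |
    let B := ball x0 (2 * r) in
    (0 < mu B)%E /\
    ((C * r `^ a)%:E <= conditional mu B
       [set x | hitting_time R g B x <= (r `^ (- dmu + e))%:E])%E]).

(* Main.v *)
Require Import Defs.
From mathcomp Require Import all_boot all_order all_algebra.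
From mathcomp Require Import all_classical all_reals all_analysis.
From mathcomp Require Import finmap measurable_realfun ring lra.

Set Implicit Arguments.
Unset Strict Implicit.
Unset Printing Implicit Defensive.

Import Order.TTheory GRing.Theory Num.Theory.
Import numFieldNormedType.Exports.

Local Open Scope classical_set_scope.
Local Open Scope ring_scope.

(** Both bounds come from covering most of the space by few balls. Fix r and
    a scale s, and let G be a set of centers x with mu (ball x s) >= c. The
    balls of radius s around the points of a 2s-separated subset of G are
    disjoint, so such a subset has at most 1/c points, and when it is maximal
    the balls of radius 2s cover G ([separated_net]). Hence an event E that has
    measure at most b inside each of these larger balls satisfies
    mu E <= mu (~` G) + b / c ([measure_le_separated_net]).

    For late returns take s = r/4 and B = ball x (r/2). Since B has diameter at
    most r, a point of B that takes time at least t to come back r-close to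
    itself takes at least that long to come back to B. The points of B with
    this property have disjoint preimages under the first iterates of g, hence
    measure at most 1/t: this is the part of Kac's lemma that is needed
    ([measure_late_return_le]). With t = r^(-dmu-e) and c = (r/4)^(dmu+gamma e)
    the quotient b / c is of order r^((1-gamma) e), and ~` G is the event whose
    rate is psi(gamma e), at the scale r/4.

    For early returns take s = r/2. A point of ball x r that comes back r-close
    to itself by time t comes back to B = ball x (2r) by time t. Away from the
    event of rate varphi the conditional probability of this is below C r^a,
    and away from the event of rate psi(-e2), at the scale 2r, the measure of B
    is at most (2r)^(dmu-e2). So b = C r^a (2r)^(dmu-e2),
    c = (r/2)^(dmu+gamma e), and b / c is of order r^(a-e2-gamma e).

    The exponents pass from measures to rates through [lower_rate_ge] and
    [lower_rate_gt]; constant factors and the changes of scale do not affect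
    them. All the events are measurable because the measures of the relevant
    sets depend semicontinuously on the center
    ([measurable_fun_measure_section]) and because a compact metric space has
    finite nets at every scale ([measurable_return_set]). *)

(** * Logarithmic rates as power bounds *)

Lemma lte_real_between (R : realType) (x y : \bar R) :
  (x < y)%E -> exists s : R, (x < s%:E < y)%E.
Proof.
case: x y => [x| |] [y| |] //; rewrite ?lte_fin => xy.
- by exists ((x + y) / 2); rewrite !lte_fin midf_lt// midf_lt.
- by exists (x + 1); rewrite lte_fin ltrDl ltr01 ltry.
- by exists (y - 1); rewrite ltNyr lte_fin gtrBl ltr01.
- by exists 0; rewrite ltNyr ltry.
Qed.

(** Dividing by ln r < 0 reverses the inequality between logarithms; at m = 0
    both sides hold, because lne 0 = -oo. *)
Lemma lee_log_ratio (R : realType) (r s : R) (m : \bar R) : 0 < r < 1 ->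
  (s%:E <= (ln r)^-1%:E * lne m)%E = (m <= (r `^ s)%:E)%E.
Proof.
move=> r01; have lr := ln_lt0 r01; have r0 : 0 < r by case/andP: r01.
case: m => [m| |] /=; last 2 first.
- by rewrite lt0_muley ?lte_fin ?invr_lt0.
- by rewrite lt0_muleNy ?lte_fin ?invr_lt0// leey leNye.
case: ifPn => [m0|]; last rewrite -ltNge => m0.
  rewrite lt0_muleNy ?lte_fin ?invr_lt0// leey lee_fin.
  by rewrite (le_trans m0)// powR_ge0.
rewrite !lee_fin -[RHS]ler_ln ?posrE ?powR_gt0// ln_powR.
by rewrite -ler_ndivlMl ?invr_lt0 ?invrK 1?mulrC.
Qed.

Lemma log_ratio_lee (R : realType) (r s : R) (m : \bar R) : 0 < r < 1 ->
  ((ln r)^-1%:E * lne m <= s%:E)%E = ((r `^ s)%:E <= m)%E.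
Proof.
move=> r01; have lr := ln_lt0 r01; have r0 : 0 < r by case/andP: r01.
case: m => [m| |] /=; last 2 first.
- by rewrite lt0_muley ?lte_fin ?invr_lt0// leey leNye.
- by rewrite lt0_muleNy ?lte_fin ?invr_lt0.
case: ifPn => [m0|]; last rewrite -ltNge => m0.
  rewrite lt0_muleNy ?lte_fin ?invr_lt0// lee_fin.
  by rewrite [RHS]leNgt (le_lt_trans m0)// powR_gt0.
rewrite !lee_fin -[RHS]ler_ln ?posrE ?powR_gt0// ln_powR.
by rewrite -ler_ndivrMl ?invr_lt0 ?invrK 1?mulrC.
Qed.

Lemma log_quotient (R : realType) (r : R) (m : \bar R) : 0 < r < 1 ->
  (lne m / (- ln r)%:E = - ((ln r)^-1%:E * lne m))%E.
Proof.
move=> r01; have lr := ln_lt0 r01.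
rewrite inver oppr_eq0 lt_eqF// invrN EFinN muleN muleC //.
Qed.

Lemma near_right0_scale (R : realType) (c : R) (P : R -> Prop) : 0 < c ->
  (\forall r \near 0^'+, P r) -> \forall r \near 0^'+, P (c * r).
Proof.
move=> c0 /nbhs_right0P [d /= d0 dP].
apply/nbhs_right0P; exists (d / c); first by rewrite /= divr_gt0.
move=> e /= ed e0; rewrite add0r.
rewrite -[c * e]add0r; apply: dP => /=; last exact: mulr_gt0.
move: ed; rewrite !sub0r !normrN normrM (gtr0_norm c0).
by rewrite ltr_pdivlMr// mulrC.
Qed.

Section rates.
Context (disp : measure_display) (R : realType).
Context (X : measurableMetricType disp R) (mu : probability X R).

(** The slack between s and x absorbs the constant K, as K * r ^ d tends to 0
    with r for every d > 0; this is what makes rates insensitive to constants. *)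
Lemma lower_rate_ge (x : \bar R) (S : R -> set X) :
  (forall s : R, (s%:E < x)%E -> exists K : R,
    \forall r \near 0^'+, (mu (S r) <= (K * r `^ s)%:E)%E) ->
  (x <= lower_rate mu S)%E.
Proof.
move=> H; rewrite leNgt; apply/negP => /lte_real_between[s /andP[ls sx]].
have [s' /andP[]] := lte_real_between sx; rewrite lte_fin => ss' s'x.
have [K HK] := H _ s'x.
move: ls; rewrite ltNge => /negP; apply.
have small : \forall r \near 0^'+, K * r `^ (s' - s) <= 1.
  have [K0|K0] := leP K 0.
    by near=> r; rewrite (le_trans _ ler01)// mulr_le0_ge0// powR_ge0.
  have ss0 : 0 < s' - s by rewrite subr_gt0.
  have /cvgrPdist_le/(_ K^-1) := powR_cvg0 ss0.
  rewrite invr_gt0 => /(_ K0) near_small; apply: filterS near_small => r.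
  by rewrite sub0r normrN ger0_norm ?powR_ge0// -ler_pdivlMl ?mulr1.
rewrite /lower_rate limf_einfE; apply: le_ereal_sup_tmp.
exists (ereal_inf [set ((ln r)^-1%:E * lne (mu (S r)))%E | r in
   [set r | 0 < r < 1 /\ (mu (S r) <= (r `^ s)%:E)%E]]).
  exists [set r | 0 < r < 1 /\ (mu (S r) <= (r `^ s)%:E)%E] => //.
  near=> r => /=.
  have r0 : 0 < r by near: r; exact: nbhs_right_gt.
  have r1 : r < 1 by near: r; exact: nbhs_right_lt.
  split; first by rewrite r0 r1.
  apply: (@le_trans _ _ (K * r `^ s')%:E); first by near: r.
  rewrite lee_fin -[s' in leLHS](subrK s) powRD; last first.
    by apply/implyP => _; rewrite gt_eqF.
  rewrite mulrA ler_piMl ?powR_ge0//.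
  by near: r.
apply/ereal_infP => _ [r [r01 rS] <-].
by rewrite lee_log_ratio.
Unshelve. all: by end_near. Qed.

Lemma lower_rate_gt (s : R) (S : R -> set X) :
  (s%:E < lower_rate mu S)%E ->
  \forall r \near 0^'+, (mu (S r) <= (r `^ s)%:E)%E.
Proof.
rewrite /lower_rate limf_einfE => /ereal_sup_gt[_ [V FV <-]] sV.
near=> r.
have r0 : 0 < r by near: r; exact: nbhs_right_gt.
have r1 : r < 1 by near: r; exact: nbhs_right_lt.
rewrite -lee_log_ratio ?r0//; apply: (le_trans (ltW sV)).
apply: ereal_inf_lbound; exists r => //.
by near: r.
Unshelve. all: by end_near. Qed.

End rates.

(** * Hitting times *)

Section hitting_time.
Context (R : realType) (X : Type) (g : X -> X).

Lemma hitting_time_geP (A : set X) (x : X) (t : R) :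
  (t%:E <= hitting_time R g A x)%E <->
  forall n, (1 <= n)%N -> A (iter n g x) -> t <= n%:R.
Proof.
split => [/ereal_infP H n n1 An|H].
  by rewrite -lee_fin; apply: H; exists n.
by apply/ereal_infP => _ [n [n1 An] <-]; rewrite lee_fin; exact: H.
Qed.

Lemma hitting_time_leP (A : set X) (x : X) (t : R) : 0 <= t ->
  (hitting_time R g A x <= t%:E)%E <->
  exists n, [/\ (1 <= n)%N, n%:R <= t & A (iter n g x)].
Proof.
move=> t0; split => [|[n [n1 nt An]]]; last first.
  by apply: ge_ereal_inf; exists n%:R%:E; rewrite ?lee_fin//; exists n.
apply: contraPP => /forallNP noreturn; apply/negP; rewrite -ltNge.
(* The integers above t stay a definite distance away from it. *)
apply: (@lt_le_trans _ _ (Num.trunc t).+1%:R%:E).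
  by rewrite lte_fin; have /andP[] := truncn_itv t0.
apply/hitting_time_geP => n n1 An; rewrite ler_nat ltnNge; apply/negP => nt.
apply: (noreturn n); split => //.
by apply: le_trans (_ : (Num.trunc t)%:R <= t); rewrite ?ler_nat// truncn_le.
Qed.

Lemma hitting_time_subset (A B : set X) (x : X) :
  A `<=` B -> (hitting_time R g B x <= hitting_time R g A x)%E.
Proof.
move=> AB; apply: le_ereal_inf => _ [n [n1 An] <-].
by exists n => //; split => //; exact: AB.
Qed.

End hitting_time.

(** The target A x may depend on the starting point, which covers hitting times
    of a fixed set and return times to a moving ball at once. *)
Section measurable_hitting.
Context (disp : measure_display) (R : realType).
Context (X : measurableType disp) (g : X -> X) (t : R).
Context (A : X -> set X).
Hypothesis mA : forall n, measurable [set x | A x (iter n g x)].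

Lemma measurable_hitting_time_le : 0 <= t ->
  measurable [set x | (hitting_time R g (A x) x <= t%:E)%E].
Proof.
move=> t0.
rewrite [X in measurable X](_ : _ =
  \bigcup_(n in [set n | (1 <= n)%N /\ n%:R <= t]) [set x | A x (iter n g x)]).
  by apply: bigcup_measurable => n _; exact: mA.
apply/seteqP; split => x /=.
  by move/hitting_time_leP => /(_ t0)[n [n1 nt An]]; exists n.
by move=> [n [n1 nt] An]; apply/hitting_time_leP => //; exists n.
Qed.

Lemma measurable_hitting_time_ge :
  measurable [set x | (t%:E <= hitting_time R g (A x) x)%E].
Proof.
rewrite [X in measurable X](_ : _ = ~`
  (\bigcup_(n in [set n | (1 <= n)%N /\ n%:R < t]) [set x | A x (iter n g x)])).
  by apply: measurableC; apply: bigcup_measurable => n _; exact: mA.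
apply/seteqP; split => x /=.
  move/hitting_time_geP => tx [n [n1 nt] An].
  by have := tx n n1 An; rewrite leNgt nt.
move=> tx; apply/hitting_time_geP => n n1 An; rewrite leNgt; apply/negP => nt.
by apply: tx; exists n.
Qed.

End measurable_hitting.

(** * Kac's bound on late returns *)

Section kac.
Context (disp : measure_display) (R : realType).
Context (X : measurableMetricType disp R) (mu : probability X R) (g : X -> X).
Hypothesis g_measurable : measurable_fun [set: X] g.
Hypothesis g_invariant : measure_invariant mu g.

Lemma measurable_iter_preimage (n : nat) (A : set X) :
  measurable A -> measurable (iter n g @^-1` A).
Proof.
elim: n A => [//|n IHn] A mA.
rewrite (_ : _ @^-1` A = iter n g @^-1` (g @^-1` A)) //.
by apply: IHn; rewrite -[_ @^-1` _]setTI; exact: g_measurable.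
Qed.

Lemma measure_iter_preimage (n : nat) (A : set X) :
  measurable A -> mu (iter n g @^-1` A) = mu A.
Proof.
elim: n A => [//|n IHn] A mA.
rewrite (_ : _ @^-1` A = iter n g @^-1` (g @^-1` A)) //.
rewrite IHn ?g_invariant//.
by rewrite -[_ @^-1` _]setTI; exact: g_measurable.
Qed.

(** The preimages of A under the iterates of order less than n are disjoint and
    all have the measure of A. *)
Lemma measure_no_early_return (n : nat) (A : set X) : measurable A ->
  (forall x k, A x -> (0 < k < n)%N -> ~ A (iter k g x)) ->
  (n%:R%:E * mu A <= 1)%E.
Proof.
move=> mA noret.
have mF k : `I_n k -> measurable (iter k g @^-1` A).
  by move=> _; exact: measurable_iter_preimage.
have tF : trivIset `I_n (fun k => iter k g @^-1` A).
  have disj i j x : (i < j < n)%N -> A (iter i g x) -> ~ A (iter j g x).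
    move=> /andP[ij jn] Ai; rewrite -(subnK (ltnW ij)) iterD; apply: noret => //.
    by rewrite subn_gt0 ij (leq_ltn_trans (leq_subr _ _)).
  move=> i j /= ni nj [x [Ai Aj]]; apply/eqP; case: ltngtP => // ij.
    by case: (disj i j x); rewrite ?ij.
  by case: (disj j i x); rewrite ?ij.
have := measure_fin_bigcup mu (finite_II n) tF mF.
rewrite -fsbig_ord.
rewrite (eq_bigr (fun=> mu A)) => [|i _]; last exact: measure_iter_preimage.
rewrite -(fineK (fin_num_measure mu A mA)) sumEFin sumr_const card_ord.
rewrite -EFinM mulr_natl => <-.
apply: probability_le1; apply: bigcup_measurable => k; exact: mF.
Qed.

(** The points of A that return late form a set without early returns, to which
    [measure_no_early_return] applies. The result is what Chebyshev's inequality
    gives from Kac's lemma. *)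
Lemma measure_late_return_le (t : R) (A : set X) : measurable A -> 0 < t ->
  (mu (A `&` [set x | (t%:E <= hitting_time R g A x)%E]) <= t^-1%:E)%E.
Proof.
move=> mA t0; set E := A `&` _.
have mE : measurable E.
  apply: measurableI => //; apply: (measurable_hitting_time_ge t (A := fun=> A)).
  by move=> n; exact: measurable_iter_preimage.
(* Points of E stay out of A at all times before n, the least integer >= t. *)
have /andP[c1 c2] := ceil_itv t.
have c0 : (0 <= Num.ceil t)%R by rewrite -(ler_int R) (le_trans (ltW t0)).
have [n cn] : exists n : nat, Num.ceil t = n%:Z.
  by exists `|Num.ceil t|%N; rewrite gez0_abs.
move: c1 c2; rewrite cn intrD mulrN1z -!pmulrn ltrBlDr => c1 c2.
have /measure_no_early_return -/(_ n) nE := mE.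
rewrite -[leRHS]mul1e.
rewrite lee_pdivlMr// muleC.
apply: le_trans (nE _); first by rewrite lee_wpmul2r// lee_fin.
move=> x k [Ax /hitting_time_geP xt] /andP[k0 kn] [Ak _].
have := xt k k0 Ak; rewrite leNgt => /negP; apply.
by rewrite -(ltrD2r 1); apply: le_lt_trans c1; rewrite natr1 ler_nat.
Qed.

End kac.

(** * Metric balls *)

Section metric_balls.
Context (R : realType) (X : metricType R).

Lemma open_metric_ball (x : X) (r : R) : open (ball x r).
Proof.
rewrite openE => y; rewrite ballEmdist /= => xy.
apply/nbhs_ballP; exists (r - mdist x y); first by rewrite /= subr_gt0.
move=> z yz; rewrite -ballEmdist.
move: yz; rewrite !ballEmdist /= => yz.
by rewrite (le_lt_trans (metric_triangle x y z))// addrC -ltrBrDr.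
Qed.

Lemma ball_smaller (x y : X) (r : R) : ball x r y ->
  exists k, ball x (r - k.+1%:R^-1) y.
Proof.
rewrite ballEmdist /= => /ltr_add_invr[k xyk].
by exists k; rewrite ballEmdist /= ltrBrDr.
Qed.

End metric_balls.

(** * Separated nets *)

Section covering.
Context (disp : measure_display) (R : realType).
Context (X : measurableMetricType disp R) (mu : probability X R).
Hypothesis open_meas : forall U : set X, open U -> measurable U.

Let mball (x : X) (r : R) : measurable (ball x r).
Proof. by apply: open_meas; exact: open_metric_ball. Qed.

Lemma separated_card_le (c s : R) (xs : seq X) :
  (forall x, x \in xs -> c%:E <= mu (ball x s))%E ->
  pairwise (fun x y => ~~ `[< ball x (2 * s) y >]) xs ->
  (size xs)%:R * c <= 1.
Proof.
move=> cxs sep; rewrite -lee_fin.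
apply: (@le_trans _ _ (mu (\big[setU/set0]_(x <- xs) ball x s))); last first.
  by apply: probability_le1; apply: bigsetU_measurable.
elim: xs cxs sep => [|x xs IH] cxs; first by rewrite mul0r measure_ge0.
rewrite pairwise_cons => /andP[/allP sepx sep].
rewrite big_cons measureU //=; first last.
- rewrite -subset0 => z [xz]; rewrite -bigcup_seq => -[y /= yxs yz].
  have /negP := sepx y yxs; apply; apply/asboolP.
  rewrite mulr_natl mulr2n; apply: ball_triangle xz _; exact: ball_sym.
- exact: bigsetU_measurable.
rewrite [(size xs).+1%:R]mulrS [(1 + _) * c]mulrDl mul1r EFinD leeD//.
  by apply: cxs; rewrite mem_head.
by apply: IH => // y yxs; apply: cxs; rewrite in_cons yxs orbT.
Qed.

(** A separated family in G that does not cover G can be enlarged, and the bound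
    on the size of such families stops the process. *)
Lemma separated_net (G : set X) (c s : R) : 0 < c ->
  (forall x, G x -> c%:E <= mu (ball x s))%E ->
  exists xs : seq X, [/\ (forall x, x \in xs -> G x), (size xs)%:R * c <= 1 &
    forall y, G y -> exists2 x, x \in xs & ball x (2 * s) y].
Proof.
move=> c0 Gc.
pose sep xs := (forall x, x \in xs -> G x) /\
  pairwise (fun x y => ~~ `[< ball x (2 * s) y >]) xs.
have card xs : sep xs -> (size xs)%:R * c <= 1.
  by move=> [xsG]; apply: separated_card_le => x /xsG; exact: Gc.
apply: contrapT => nonet.
have grow n : exists2 xs, sep xs & size xs = n.
  elim: n => [|n [xs sepxs xsn]]; first by exists [::].
  have [y [Gy yfar]] : exists y, G y /\ forall x, x \in xs -> ~ ball x (2 * s) y.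
    apply: contrapT => covered; apply: nonet; exists xs; split.
    - by case: sepxs.
    - exact: card.
    - move=> y Gy; apply: contrapT => yfar; apply: covered; exists y; split=> //.
      by move=> x xxs xy; apply: yfar; exists x.
  case: sepxs => xsG xssep; exists (y :: xs); last by rewrite /= xsn.
  split; first by move=> x; rewrite in_cons => /predU1P[->//|/xsG].
  rewrite pairwise_cons xssep andbT; apply/allP => x xxs; apply/asboolPn.
  by move/ball_sym; exact: yfar.
have [xs sepxs xsn] := grow (Num.trunc c^-1).+1.
have /= := card xs sepxs; rewrite xsn leNgt => /negP; apply.
rewrite -ltr_pdivrMr// mul1r.
have ci : 0 <= c^-1 by rewrite invr_ge0 ltW.
by have /andP[] := truncn_itv ci.
Qed.

Lemma measure_le_separated_net (E G : set X) (b c s : R) :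
  measurable E -> measurable G -> 0 < c -> 0 <= b ->
  (forall x, G x -> c%:E <= mu (ball x s))%E ->
  (forall x, G x -> mu (E `&` ball x (2 * s)) <= b%:E)%E ->
  (mu E <= mu (~` G) + (b / c)%:E)%E.
Proof.
move=> mE mG c0 b0 Gc Gb.
have [xs [xsG xsc cover]] := separated_net c0 Gc.
pose U := \big[setU/set0]_(x <- xs) (E `&` ball x (2 * s)).
have mEb x : measurable (E `&` ball x (2 * s)) by exact: measurableI.
have mU : measurable U by exact: bigsetU_measurable.
have EU : E `<=` ~` G `|` U.
  move=> x Ex; have [Gx|nGx] := pselect (G x); last by left.
  right; rewrite /U -bigcup_seq; have [y yxs yx] := cover x Gx.
  by exists y.
apply: (@le_trans _ _ (mu (~` G `|` U))).
  apply: le_measure => //; apply: mem_set => //.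
  by apply: measurableU => //; exact: measurableC.
apply: (le_trans (measureU2 _ (measurableC mG) mU)); rewrite leeD2l//.
apply: (@le_trans _ _ ((size xs)%:R * b)%:E).
  rewrite /U; elim: xs xsG {xsc cover mU EU U} => [|x xs IH] xsG.
    by rewrite big_nil measure0 mul0r.
  rewrite big_cons; apply: le_trans (measureU2 _ _ _) _ => //.
    exact: bigsetU_measurable.
  rewrite /= [(size xs).+1%:R]mulrS [(1 + _) * b]mulrDl mul1r EFinD leeD//.
    by apply: Gb; apply: xsG; rewrite mem_head.
  by apply: IH => y yxs; apply: xsG; rewrite in_cons yxs orbT.
by rewrite lee_fin mulrC ler_wpM2l// -[leRHS]mul1r ler_pdivlMr.
Qed.

End covering.

(** * Measurability of the events *)

Lemma measurable_fun_ereal_gt d (T : measurableType d) (R : realType)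
    (f : T -> \bar R) :
  (forall c, measurable [set x | (c%:E < f x)%E]) -> measurable_fun [set: T] f.
Proof.
move=> mf.
apply: (measurability _ (ErealGenOInfty.measurableE R)) => _ [_ [c ->] <-].
by rewrite setTI preimage_itvoy; exact: mf.
Qed.

Section semicontinuity.
Context (disp : measure_display) (R : realType).
Context (X : measurableMetricType disp R) (mu : probability X R).
Hypothesis open_meas : forall U : set X, open U -> measurable U.

(** x |-> mu (F r x) is lower semicontinuous: if mu (F r x) > c, then already
    mu (F (r - 1/k) x) > c for some k by continuity from below, and F r y
    contains F (r - 1/k) x for every y within 1/k of x. *)
Lemma measurable_fun_measure_section (F : R -> X -> set X) (r : R) :
  (forall s x, measurable (F s x)) ->
  (forall s d x y, ball x d y -> F s x `<=` F (s + d) y) ->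
  (forall x, F r x `<=` \bigcup_k F (r - k.+1%:R^-1) x) ->
  measurable_fun [set: X] (fun x => mu (F r x)).
Proof.
move=> mF Fmove Fcont.
have Fmono s s' x : s <= s' -> F s x `<=` F s' x.
  rewrite le_eqVlt => /predU1P[-> //|ss'].
  rewrite -[s'](subrK s) addrC; apply: Fmove.
  by apply: ballxx; rewrite subr_gt0.
apply: measurable_fun_ereal_gt => c; apply: open_meas.
rewrite openE => x /= cx.
have Fr : F r x = \bigcup_k F (r - k.+1%:R^-1) x.
  apply/seteqP; split => //; apply: bigcup_sub => k _; apply: Fmono.
  by rewrite gerBl.
have nd : {homo (fun k => F (r - k.+1%:R^-1) x) : n m / (n <= m)%N >-> (n <= m)%O}.
  move=> n m nm; apply/subsetPset; apply: Fmono.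
  by rewrite lerB// lef_pV2 ?posrE// ler_nat.
have := nondecreasing_cvg_mu (mu := mu) (fun k => mF (r - k.+1%:R^-1) x)
  (bigcup_measurable (fun k _ => mF (r - k.+1%:R^-1) x)) nd.
rewrite -Fr => mucvg.
have [k ck] : exists k, (c%:E < mu (F (r - k.+1%:R^-1)%R x))%E.
  apply: contrapT => small; move: cx; rewrite ltNge => /negP; apply.
  rewrite -(cvg_lim _ mucvg)//; apply: lime_le; first by apply/cvg_ex; eexists; exact: mucvg.
  by apply: nearW => k /=; rewrite leNgt; apply/negP => ?; apply: small; exists k.
apply/nbhs_ballP; exists (k.+1%:R^-1) => //= y xy.
apply: (lt_le_trans ck).
apply: le_measure; try exact: mem_set.
by rewrite -[in X in _ `<=` X](subrK k.+1%:R^-1 r); exact: Fmove.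
Qed.

Lemma measurable_fun_measure_ball (r : R) :
  measurable_fun [set: X] (fun x => mu (ball x r)).
Proof.
apply: (measurable_fun_measure_section (F := fun s x => ball x s)) => //.
- by move=> s x; apply: open_meas; exact: open_metric_ball.
- by move=> s d x y xy z xz; rewrite addrC; apply: ball_triangle xz; exact: ball_sym.
- by move=> x y /ball_smaller[k]; exists k.
Qed.

End semicontinuity.

Section return_measurability.
Context (disp : measure_display) (R : realType).
Context (X : measurableMetricType disp R) (mu : probability X R) (g : X -> X).
Hypothesis open_meas : forall U : set X, open U -> measurable U.
Hypothesis g_measurable : measurable_fun [set: X] g.

Let mball (x : X) (r : R) : measurable (ball x r).
Proof. by apply: open_meas; exact: open_metric_ball. Qed.

Lemma measurable_fun_measure_short_return (r t : R) : 0 <= t ->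
  measurable_fun [set: X] (fun x =>
    mu ([set z | (hitting_time R g (ball x r) z <= t%:E)%E] `&` ball x r)).
Proof.
move=> t0.
apply: (measurable_fun_measure_section mu open_meas (F := fun s x =>
  [set z | (hitting_time R g (ball x s) z <= t%:E)%E] `&` ball x s)).
- move=> s x; apply: measurableI => //.
  apply: (measurable_hitting_time_le (A := fun=> ball x s)) => // n.
  exact: measurable_iter_preimage.
- have ballS s d (x y : X) : ball x d y -> ball x s `<=` ball y (s + d).
    by move=> xy z xz; rewrite addrC; apply: ball_triangle xz; exact: ball_sym.
  move=> s d x y xy z /= [zt xz]; split; last exact: ballS xz.
  by apply: le_trans zt; apply: hitting_time_subset; exact: ballS.
- move=> x z /= [/hitting_time_leP -/(_ t0)[n [n1 nt xgz]]].
  move: xgz => /ball_smaller[k xgz] /ball_smaller[l xz].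
  have inv_le i j : (i <= j)%N -> r - i.+1%:R^-1 <= r - j.+1%:R^-1.
    by move=> ij; rewrite lerB// lef_pV2 ?posrE// ler_nat.
  exists (maxn k l) => //; split => /=.
    apply/hitting_time_leP => //; exists n; split => //.
    by apply: le_ball xgz; apply: inv_le; exact: leq_maxl.
  by apply: le_ball xz; apply: inv_le; exact: leq_maxr.
Qed.

(** The event concerns x and its iterate jointly; the finite nets D k express it
    as a countable union of conditions on each of them separately. *)
Lemma measurable_return_set (X_compact : compact [set: X]) (r : R) (n : nat) :
  measurable [set x | ball x r (iter n g x)].
Proof.
have net (k : nat) : exists D : {fset X}, forall x, exists2 y, y \in D & ball y k.+1%:R^-1 x.
  move: X_compact; rewrite compact_cover.
  move=> /(_ X setT (fun y => ball y k.+1%:R^-1)) [||D _ Dcov].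
  - by move=> y _; exact: open_metric_ball.
  - by move=> x _; exists x => //; exact: ballxx.
  - by exists D => x; have [y yD yx] := Dcov x I; exists y.
have [D Dnet] := choice net.
rewrite [X in measurable X](_ : _ = \bigcup_k \bigcup_(y in [set` D k])
  (ball y k.+1%:R^-1 `&` iter n g @^-1` ball y (r - k.+1%:R^-1))).
  apply: bigcupT_measurable => k; apply: fin_bigcup_measurable => // y _.
  by apply: measurableI => //; exact: measurable_iter_preimage.
apply/seteqP; split => x /=; last first.
  move=> [k _ [y _ [/= yx ygx]]].
  rewrite -(subrK k.+1%:R^-1 r) addrC; apply: ball_triangle ygx.
  exact: ball_sym.
(* The mesh 1/(k+1) is at most half of the slack r - mdist x (iter n g x). *)
rewrite ballEmdist /= => xgx.
have slack : 0 < (r - mdist x (iter n g x)) / 2 by rewrite divr_gt0// subr_gt0.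
have [k] := ltr_add_invr slack; rewrite add0r => k_slack.
have [y yD yx] := Dnet k x; exists k => //; exists y => //; split => //.
move: yx; rewrite !ballEmdist /= => yx.
rewrite (le_lt_trans (metric_triangle y x _))//.
set d := k.+1%:R^-1 in yx k_slack *.
lra.
Qed.

End return_measurability.

(** * Estimates at a fixed scale *)

Lemma conditional_geE (disp : measure_display) (R : realType)
    (X : measurableMetricType disp R) (mu : probability X R) (A B : set X)
    (b : R) : measurable B -> (0 < mu B)%E ->
  (b%:E <= conditional mu B A)%E = (b%:E * mu B <= mu (A `&` B))%E.
Proof.
move=> mB; rewrite /conditional -(fineK (fin_num_measure mu B mB)) lte_fin => B0.
by rewrite inver gt_eqF// lee_pdivlMr.
Qed.

Section return_estimates.
Context (disp : measure_display) (R : realType).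
Context (X : measurableMetricType disp R) (mu : probability X R) (g : X -> X).
Hypothesis X_compact : compact [set: X].
Hypothesis open_meas : forall U : set X, open U -> measurable U.
Hypothesis g_measurable : measurable_fun [set: X] g.

Let mball (x : X) (r : R) : measurable (ball x r).
Proof. by apply: open_meas; exact: open_metric_ball. Qed.

Let mbig (c r : R) : measurable [set x | (c%:E <= mu (ball x r))%E].
Proof.
rewrite -[X in measurable X]setTI.
by apply: emeasurable_fun_c_infty => //; exact: measurable_fun_measure_ball.
Qed.

Let msmall (c r : R) : measurable [set x | (mu (ball x r) <= c%:E)%E].
Proof.
rewrite -[X in measurable X]setTI.
by apply: emeasurable_fun_infty_c => //; exact: measurable_fun_measure_ball.
Qed.

(** The balls of radius r/2 around the centers have diameter at most r, so a
    return to such a ball is a return r-close to the starting point. *)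
Lemma late_return_le (g_invariant : measure_invariant mu g) (r t c : R) :
  0 < t -> 0 < c ->
  (mu [set x | (t%:E <= return_time g r x)%E] <=
   mu (~` [set x | (c%:E <= mu (ball x (4^-1 * r)))%E]) + (t^-1 / c)%:E)%E.
Proof.
move=> t0 c0.
apply: (measure_le_separated_net (s := 4^-1 * r) open_meas) => //.
- apply: (measurable_hitting_time_ge t (A := fun x => ball x r)) => n.
  exact: measurable_return_set.
- by rewrite invr_ge0 ltW.
move=> x _; set B := ball x _.
have mB : measurable B by exact: mball.
apply: le_trans (measure_late_return_le g_measurable g_invariant mB t0).
apply: le_measure; try apply: mem_set.
- apply: measurableI => //.
  apply: (measurable_hitting_time_ge t (A := fun x => ball x r)) => n.
  exact: measurable_return_set.
- apply: measurableI => //.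
  apply: (measurable_hitting_time_ge t (A := fun=> B)) => n.
  exact: measurable_iter_preimage.
move=> z [tz Bz]; split => //; move: tz => /=.
move/hitting_time_geP => tz; apply/hitting_time_geP => n n1 Bgz; apply: tz => //.
rewrite (_ : r = 2 * (4^-1 * r) + 2 * (4^-1 * r)); last lra.
by apply: ball_triangle Bgz; exact: ball_sym.
Qed.

Lemma measurable_varphi_set (r t b : R) : 0 <= t ->
  measurable [set x0 : X | let B := ball x0 r in
    (0 < mu B)%E /\
    (b%:E <= conditional mu B [set x | hitting_time R g B x <= t%:E])%E].
Proof.
move=> t0.
pose f x := mu (ball x r).
pose h x := mu ([set z | (hitting_time R g (ball x r) z <= t%:E)%E] `&` ball x r).
have mf : measurable_fun [set: X] f by exact: measurable_fun_measure_ball.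
have mh : measurable_fun [set: X] h by exact: measurable_fun_measure_short_return.
rewrite [X in measurable X](_ : _ =
    ([set: X] `&` [set x | (0 < f x)%E]) `&` ([set: X] `&` [set x | (b%:E * f x <= h x)%E])).
  apply: measurableI; first exact: emeasurable_fun_o_infty.
  by apply: measurable_lee => //; exact: measurable_funeM.
rewrite !setTI; apply/seteqP; split => x /= [f0].
  by rewrite conditional_geE.
by split => //; rewrite conditional_geE.
Qed.

(** A return r-close to a point of ball x r is a return to ball x (2r), and a
    center x outside the event in the middle has few such points. *)
Lemma early_return_le (r t b c m : R) :
  0 <= t -> 0 <= b -> 0 < c -> 0 <= m ->
  (mu [set x | (return_time g r x <= t%:E)%E] <=
   mu (~` [set x | (c%:E <= mu (ball x (2^-1 * r)))%E]) +
   (mu [set x0 | let B := ball x0 (2 * r) in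
      (0 < mu B)%E /\
      (b%:E <= conditional mu B [set x | hitting_time R g B x <= t%:E])%E] +
    mu (~` [set x | (mu (ball x (2 * r)) <= m%:E)%E])) + (b * m / c)%:E)%E.
Proof.
move=> t0 b0 c0 m0.
set Phi := (X in (_ <= _ + (mu X + _) + _)%E).
set thick := [set x | (c%:E <= _)%E]; set thin := [set x | (_ <= m%:E)%E].
have mPhi : measurable Phi by exact: (measurable_varphi_set (2 * r) b t0).
have mthick : measurable thick by exact: mbig.
have mthin : measurable thin by exact: msmall.
have mE : measurable [set x | (return_time g r x <= t%:E)%E].
  apply: (measurable_hitting_time_le (A := fun x => ball x r)) => // n.
  exact: measurable_return_set.
have mG : measurable (thick `&` (~` Phi `&` thin)).
  by apply: measurableI => //; apply: measurableI => //; exact: measurableC.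
have := @measure_le_separated_net _ _ _ mu open_meas _ _ (b * m) c (2^-1 * r) mE mG c0.
move=> /(_ (mulr_ge0 b0 m0)) H; apply: le_trans (H _ _) _ => {H}.
- by move=> x [].
- move=> x [_ [nPhi xthin]]; rewrite mulrA divff// mul1r.
  pose B := ball x (2 * r); have mB : measurable B by exact: mball.
  have mH : measurable [set z | (hitting_time R g B z <= t%:E)%E].
    apply: (measurable_hitting_time_le (A := fun=> B)) => // n.
    exact: measurable_iter_preimage.
  have mHB := measurableI _ _ mH mB.
  apply: (@le_trans _ _ (mu ([set z | (hitting_time R g B z <= t%:E)%E] `&` B))).
    apply: le_measure; try apply: mem_set => //; first exact: measurableI.
    move=> z [/hitting_time_leP -/(_ t0)[n [n1 nt zgz]] xz].
    have r2 : 2 * r = r + r by rewrite mulr_natl mulr2n.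
    have r0 : 0 <= r by move: xz; rewrite ballEmdist /= => /ltW; apply: le_trans; exact: mdist_ge0.
    split; last by apply: le_ball xz; lra.
    apply/hitting_time_leP => //; exists n; split => //.
    by rewrite /B r2; exact: ball_triangle xz zgz.
  (* nPhi gives no information when B has measure 0. *)
  have [B0|] := leP (mu B) 0%E.
    apply: (@le_trans _ _ (mu B)); first by apply: le_measure; try exact: mem_set.
    by apply: (le_trans B0); rewrite lee_fin mulr_ge0.
  move=> B0; rewrite EFinM; apply: (@le_trans _ _ (b%:E * mu B)%E); last first.
    by apply: lee_wpmul2l => //; rewrite lee_fin.
  apply: ltW; rewrite ltNge; apply/negP => bB; apply: nPhi; split => //.
  by rewrite -/B conditional_geE.
rewrite leeD2r// setCI [X in _ `|` X]setCI setCK.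
apply: (le_trans (measureU2 _ _ _)); [exact: measurableC| |].
  by apply: measurableU => //; exact: measurableC.
rewrite leeD2l//; apply: (le_trans (measureU2 _ _ _)) => //.
exact: measurableC.
Qed.

End return_estimates.

(** * The rates psi *)

Section psi_sets.
Context (disp : measure_display) (R : realType).
Context (X : measurableMetricType disp R) (mu : probability X R).

Lemma psi_pos_gt (d e s : R) : (s%:E < psi_pos mu d e)%E ->
  \forall r \near 0^'+,
    (mu (~` [set x | ((r `^ (d + e))%:E <= mu (ball x r))%E]) <= (r `^ s)%:E)%E.
Proof.
move=> /lower_rate_gt near_s; near=> r.
have r0 : 0 < r by near: r; exact: nbhs_right_gt.
have r1 : r < 1 by near: r; exact: nbhs_right_lt.
rewrite [X in mu X](_ : _ = [set x |
    [set` `]-oo, ((- d - e)%:E : \bar R)[] (lne (mu (ball x r)) / (- ln r)%:E)%E]).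
  by near: r.
apply/seteqP; split => x; rewrite /= in_itv /= log_quotient ?r0// -opprD EFinN.
  by rewrite lteN2 ltNge log_ratio_lee ?r0// => /negP.
by rewrite lteN2 ltNge log_ratio_lee ?r0// => /negP.
Unshelve. all: by end_near. Qed.

Lemma psi_neg_gt (d e s : R) : (s%:E < psi_neg mu d e)%E ->
  \forall r \near 0^'+,
    (mu (~` [set x | (mu (ball x r) <= (r `^ (d - e))%:E)%E]) <= (r `^ s)%:E)%E.
Proof.
move=> /lower_rate_gt near_s; near=> r.
have r0 : 0 < r by near: r; exact: nbhs_right_gt.
have r1 : r < 1 by near: r; exact: nbhs_right_lt.
rewrite [X in mu X](_ : _ = [set x |
    [set` `]((- d + e)%:E : \bar R), +oo[] (lne (mu (ball x r)) / (- ln r)%:E)%E]).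
  by near: r.
have -> : - d + e = - (d - e) by rewrite opprB addrC.
apply/seteqP; split => x; rewrite /= in_itv /= log_quotient ?r0// andbT EFinN.
  by rewrite lteN2 ltNge lee_log_ratio ?r0// => /negP.
by rewrite lteN2 ltNge lee_log_ratio ?r0// => /negP.
Unshelve. all: by end_near. Qed.

End psi_sets.

(** * Rates of the return times *)

Theorem theorem2p5 (disp : measure_display) (R : realType)
    (X : measurableMetricType disp R) (mu : probability X R) (g : X -> X)
    (dmu : R)
    (X_compact : compact [set: X])
    (borel_measurable : <<s [set U : set X | open U] >> `<=`
       [set A : set X | measurable A])
    (g_measurable : measurable_fun [set: X] g)
    (g_invariant : measure_invariant mu g)
    (mu_exact : exact_dimensional mu dmu)
    (e : R) (e_gt0 : 0 < e) :
  (ereal_sup [set Order.min ((1 - gamma) * e)%:E (psi_pos mu dmu (gamma * e))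
             | gamma in [set gamma : R | (0 < gamma < 1)%R]]
   <= lower_rate mu
        (fun r => [set x | (r `^ (- dmu - e))%:E <= return_time g r x]))%E
  /\
  (forall C : R -> R -> R,
    (forall a e' : R, 0 < a -> 0 < e' -> 0 < C a e') ->
    (ereal_sup [set y | exists gamma a e2 : R,
        [/\ (0 < gamma < 1)%R, (0 < a)%R, (0 < e2)%R &
         y = Order.min (- gamma * e - e2 + a)%:E
              (Order.min (psi_pos mu dmu (gamma * e))
                (Order.min (varphi mu g dmu (C a e) a e)
                           (psi_neg mu dmu e2)))]]
     <= lower_rate mu
          (fun r => [set x | return_time g r x <= (r `^ (- dmu + e))%:E]))%E).
Proof.
have open_meas (U : set X) : open U -> measurable U.
  by move=> oU; apply: borel_measurable; exact: sub_sigma_algebra.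
split=> [|C C0].
  apply/ereal_supP => _ [gamma _ <-]; apply: lower_rate_ge => s.
  rewrite lt_min lte_fin => /andP[s_gamma s_psi].
  have scale0 : 0 < 4^-1 :> R by [].
  have thick := near_right0_scale scale0 (psi_pos_gt s_psi).
  pose q := dmu + gamma * e.
  exists (4^-1 `^ s + (4^-1 `^ q)^-1); near=> r.
  have r0 : 0 < r by near: r; exact: nbhs_right_gt.
  have r1 : r < 1 by near: r; exact: nbhs_right_lt.
  have c0 : 0 < (4^-1 * r) `^ q by rewrite powR_gt0// mulr_gt0.
  apply: le_trans (late_return_le X_compact open_meas g_measurable g_invariant
    r (powR_gt0 _ r0) c0) _.
  rewrite mulrDl EFinD leeD//.
    rewrite -powRM ?(ltW r0)//; near: r.
    exact: thick.
  rewrite lee_fin powRM ?(ltW r0)// invfM mulrCA ler_pM2l ?invr_gt0 ?powR_gt0//.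
  rewrite -!powRN -powRD; last by apply/implyP => _; rewrite gt_eqF.
  by apply: ger_powR; rewrite ?r0 ?ltW// /q; lra.
apply/ereal_supP => _ [gamma [a [e2 [_ a0 _ ->]]]]; apply: lower_rate_ge => s.
rewrite !lt_min lte_fin => /and4P[s_lin s_pos s_phi s_neg].
have half0 : 0 < 2^-1 :> R by [].
have two0 : 0 < 2 :> R by [].
have thick := near_right0_scale half0 (psi_pos_gt s_pos).
have thin := near_right0_scale two0 (psi_neg_gt s_neg).
pose q := dmu + gamma * e.
exists (2^-1 `^ s + (1 + 2 `^ s) + C a e * 2 `^ (dmu - e2) * (2^-1 `^ q)^-1).
near=> r.
have r0 : 0 < r by near: r; exact: nbhs_right_gt.
have r1 : r < 1 by near: r; exact: nbhs_right_lt.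
have Ca0 : 0 < C a e by exact: C0.
have c0 : 0 < (2^-1 * r) `^ q by rewrite powR_gt0// mulr_gt0.
have b0 : 0 <= C a e * r `^ a by rewrite mulr_ge0 ?powR_ge0// ltW.
apply: le_trans (early_return_le mu X_compact open_meas g_measurable r
  (powR_ge0 r (- dmu + e)) b0 c0 (powR_ge0 (2 * r) (dmu - e2))) _.
rewrite [in leRHS]mulrDl EFinD leeD//.
  rewrite [in leRHS]mulrDl EFinD leeD//.
    rewrite -powRM ?(ltW r0)//; near: r.
    exact: thick.
  rewrite [in leRHS]mulrDl EFinD leeD//.
    by rewrite mul1r; near: r; exact: lower_rate_gt.
  rewrite -powRM ?(ltW r0)//; near: r.
  exact: thin.
(* The powers of 2 from the scales 2r and r/2 go into the constant. *)
rewrite lee_fin !powRM ?(ltW r0)// invfM.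
have -> : C a e * r `^ a * (2 `^ (dmu - e2) * r `^ (dmu - e2)) *
    ((2^-1 `^ q)^-1 * (r `^ q)^-1) =
  C a e * 2 `^ (dmu - e2) * (2^-1 `^ q)^-1 *
    (r `^ a * r `^ (dmu - e2) * (r `^ q)^-1) by ring.
rewrite ler_pM2l ?mulr_gt0 ?invr_gt0 ?powR_gt0//.
have powrD u v : r `^ u * r `^ v = r `^ (u + v).
  by rewrite powRD//; apply/implyP => _; rewrite gt_eqF.
rewrite -powRN !powrD.
by apply: ger_powR; rewrite ?r0 ?ltW// /q; lra.
Unshelve. all: by end_near. Qed.
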